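(* Let $G$ be a compact Hausdorff topological group, $(X,\theta)$ a $G$-space, and $X_G$ its enveloping space (with the enveloping action). If $\theta$ is nice, then $X$ is locally $G$-contractible if and only if $X_G$ is locally $G$-contractible.
   Context: Partial actions. A partial action of a group $G$ (identity $e$) on a set $X$ is a map $\theta:G*X\to X$, $(g,x)\mapsto g\cdot x$, defined on a subset $G*X\subseteq G\times X$ (write $\exists\, g\cdot x$ for $(g,x)\in G*X$), such that for all $g,h\in G$, $x\in X$: (PA1) if $\exists\, g\cdot x$ then $\exists\, g^{-1}\cdot(g\cdot x)$ and $g^{-1}\cdot(g\cdot x)=x$; (PA2) if $\exists\, g\cdot(h\cdot x)$ then $\exists\,(gh)\cdot x$ and $g\cdot(h\cdot x)=(gh)\cdot x$; (PA3) $\exists\, e\cdot x$ and $e\cdot x=x$. Put $X_g=\{x\in X:\exists\, g^{-1}\cdot x\}$, $\theta_g:X_{g^{-1}}\to X_g$, $x\mapsto g\cdot x$, and $G^x=\{g\in G:(g,x)\in G*X\}$. If $G$ is a topological group and $X$ a topological space, $\theta$ is topological if every $X_g$ is open in $X$ and every $\theta_g$ is a homeomorphism; continuous if $\theta$ is continuous for the subspace topology on $G*X\subseteq G\times X$; nice if it is continuous and $G*X$ is open in $G\times X$. All topological groups are Hausdorff and all partial actions are topological. A $G$-space is a pair $(X,\theta)$ with $\theta$ a continuous (topological) partial action of $G$ on the topological space $X$. The isotropy group of $x$ is $G_x=\{g\in G^x:\theta(g,x)=x\}$. Enveloping space. $X_G=(G\times X)/R$ with the quotient topology, where $(g,x)R(h,y)$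 iff $x\in X_{g^{-1}h}$ and $\theta_{h^{-1}g}(x)=y$; the class of $(g,x)$ is $[g,x]$. The enveloping action of $G$ on $X_G$ is the continuous global action $\mu(g,[h,x])=[gh,x]$. Local $G$-contractibility. For a subgroup $K\le G$, a nonempty subset $S\subseteq X$ is $K$-invariant if $\theta(k,s)\in S$ whenever $k\in K$, $s\in S$ and $(k,s)\in G*X$. $X$ is locally $G$-contractible if for each $x\in X$ and each $G_x$-invariant neighborhood $U$ of $x$ there is a $G_x$-invariant neighborhood $V\subseteq U$ of $x$ that is $G_x$-contractible in $U$, meaning: there is a continuous map $H:V\times[0,1]\to U$ such that $H_0$ is the inclusion, $H_1$ is constant with value a $G_x$-fixed point $w\in U$ (i.e. $G_x\subseteq G_w$), and each $H_t=H(\cdot,t)$ is $G_x$-equivariant, i.e. if $k\in G_x$, $v\in V$ and $(k,v)\in G*X$, then $(k,H_t(v))\in G*X$ and $\theta(k,H_t(v))=H_t(\theta(k,v))$. *)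

(* Defs.v *)
From HB Require Import structures.
From mathcomp Require Import all_boot all_order all_algebra.
From mathcomp Require Import all_classical all_reals.
From mathcomp Require Import topology normedtype.

Set Implicit Arguments.
Unset Strict Implicit.
Unset Printing Implicit Defensive.

Import Order.TTheory GRing.Theory Num.Theory.
Import numFieldNormedType.Exports.

Local Open Scope classical_set_scope.
Local Open Scope ring_scope.
Local Open Scope group_scope.
Local Open Scope quotient_scope.

HB.structure Definition PreTopologicalGroup := {G of Topological G & Group G}.

HB.mixin Record isTopologicalGroup G & PreTopologicalGroup G := {
  mulg_continuous : continuous (fun p : G * G => p.1 * p.2) ;
  invg_continuous : continuous (fun g : G => g^-1)
}.

#[short(type="topologicalGroupType")]
HB.structure Definition TopologicalGroup :=
  {G of PreTopologicalGroup G & isTopologicalGroup G}.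

(* The partial map G * X -> X is a total function [pact] together with its
   domain [pdom]; the values of [pact] outside [pdom] carry no meaning, and
   everything below only looks at [pact g x] when [pdom (g, x)]. *)
Record partial_action (G : groupType) (X : Type) := PartialAction {
  pdom : set (G * X) ;
  pact : G -> X -> X ;
  pactVK : forall g x, pdom (g, x) ->
    pdom (g^-1, pact g x) /\ pact g^-1 (pact g x) = x ;
  pactM : forall g h x, pdom (h, x) -> pdom (g, pact h x) ->
    pdom (g * h, x) /\ pact g (pact h x) = pact (g * h) x ;
  pact1 : forall x, pdom (1, x) /\ pact 1 x = x
}.

(* X_g *)
Definition pcod (G : groupType) (X : Type) (th : partial_action G X) (g : G) :
  set X := [set x | pdom th (g^-1, x)].

Definition isotropy (G : groupType) (X : Type) (th : partial_action G X)
  (x : X) : set G := [set g | pdom th (g, x) /\ pact th g x = x].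

Definition homeomorphism_on (X Y : topologicalType) (A : set X) (B : set Y)
    (f : X -> Y) : Prop :=
  [/\ set_fun A B f, {within A, continuous f} &
      exists f' : Y -> X, [/\ set_fun B A f', {within B, continuous f'},
        (forall x, A x -> f' (f x) = x) & (forall y, B y -> f (f' y) = y)]].

Section TopologicalPartialActions.
Variables (G : topologicalGroupType) (X : topologicalType).
Variable th : partial_action G X.

Definition topological_action : Prop :=
  (forall g, open (pcod th g)) /\
  (forall g, homeomorphism_on (pcod th g^-1) (pcod th g) (pact th g)).

Definition continuous_action : Prop :=
  {within pdom th, continuous (fun p : G * X => pact th p.1 p.2)}.

Definition is_G_space : Prop := topological_action /\ continuous_action.

Definition nice_action : Prop := continuous_action /\ open (pdom th).

Definition invariant_set (K : set G) (S : set X) : Prop :=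
  S !=set0 /\
  forall k s, K k -> S s -> pdom th (k, s) -> S (pact th k s).

(* [V] is [K]-contractible in [U]; only the values of [H] on [V `*` [0, 1]]
   matter. *)
Definition contractible_in (R : realType) (K : set G) (V U : set X) : Prop :=
  exists H : X * R -> X,
  [/\ {within V `*` `[0%R, 1%R], continuous H},
      (forall v t, V v -> `[0%R, 1%R]%classic t -> U (H (v, t))),
      (forall v, V v -> H (v, 0%R) = v),
      (exists w, [/\ U w, K `<=` isotropy th w &
                     forall v, V v -> H (v, 1%R) = w]) &
      (forall k v t, K k -> V v -> `[0%R, 1%R]%classic t -> pdom th (k, v) ->
         pdom th (k, H (v, t)) /\
         pact th k (H (v, t)) = H (pact th k v, t))].

Definition locally_contractible (R : realType) : Prop :=
  forall (x : X) (U : set X),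
    nbhs x U -> invariant_set (isotropy th x) U ->
    exists V : set X,
      [/\ nbhs x V, invariant_set (isotropy th x) V, V `<=` U &
          contractible_in R (isotropy th x) V U].

End TopologicalPartialActions.

Section EnvelopingSpace.
Variables (G : topologicalGroupType) (X : topologicalType).
Variable th : partial_action G X.

Definition env_rel : rel (G * X) := fun p q =>
  `[< pcod th (p.1^-1 * q.1) p.2 /\ pact th (q.1^-1 * p.1) p.2 = q.2 >].

Lemma env_relP (g h : G) (x y : X) :
  env_rel (g, x) (h, y) <->
  pdom th (h^-1 * g, x) /\ pact th (h^-1 * g) x = y.
Proof.
rewrite /env_rel /pcod /= invgM invgK; split; first by move/asboolP.
by move=> ?; apply/asboolP.
Qed.

Lemma env_rel_refl : reflexive env_rel.
Proof. by case=> g x; apply/env_relP; rewrite mulVg; exact: pact1. Qed.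

Lemma env_rel_sym : symmetric env_rel.
Proof.
suff imp p q : env_rel p q -> env_rel q p by move=> p q; apply/idP/idP; exact: imp.
case: p q => [g x] [h y] /env_relP[dx <-]; apply/env_relP.
by have := pactVK dx; rewrite invgM invgK.
Qed.

Lemma env_rel_trans : transitive env_rel.
Proof.
move=> [h y] [g x] [k z] /env_relP[dx <-] /env_relP[dy <-]; apply/env_relP.
by have [] := pactM dx dy; rewrite mulgA mulgK => ? ->.
Qed.

Definition env_equiv : equiv_rel (G * X) :=
  EquivRel env_rel env_rel_refl env_rel_sym env_rel_trans.

Definition enveloping_space : topologicalType :=
  quotient_topology {eq_quot env_equiv}.

Definition env_class (g : G) (x : X) : enveloping_space :=
  \pi_({eq_quot env_equiv})%qT (g, x).

Definition env_repr (c : enveloping_space) : G * X :=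
  repr (c : {eq_quot env_equiv}).

Definition env_act (g : G) (c : enveloping_space) : enveloping_space :=
  env_class (g * (env_repr c).1) (env_repr c).2.

Lemma env_class_eq g h x y : env_class g x = env_class h y <->
  pdom th (h^-1 * g, x) /\ pact th (h^-1 * g) x = y.
Proof.
rewrite -env_relP; split.
  by move=> e; have /eqmodP := e.
by move=> e; apply/eqmodP.
Qed.

Lemma env_reprK c : env_class (env_repr c).1 (env_repr c).2 = c.
Proof. by rewrite /env_class -surjective_pairing; exact: reprK. Qed.

(* Together with [env_reprK], this shows that [env_act] does not depend on the
   choice of representatives. *)
Lemma env_actE g h x : env_act g (env_class h x) = env_class (g * h) x.
Proof.
rewrite /env_act; move: (env_reprK (env_class h x)).
case: (env_repr _) => k y /= /env_class_eq e; apply/env_class_eq.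
by rewrite invgM -mulgA mulKg.
Qed.

Lemma env_act1 c : env_act 1 c = c.
Proof. by rewrite -[c]env_reprK env_actE mul1g. Qed.

Lemma env_actM g h c : env_act g (env_act h c) = env_act (g * h) c.
Proof. by rewrite -[c]env_reprK !env_actE mulgA. Qed.

Definition enveloping_action : partial_action G enveloping_space.
Proof.
refine (@PartialAction G enveloping_space setT env_act _ _ _).
- by move=> g c _; rewrite env_actM mulVg env_act1.
- by move=> g h c _ _; rewrite env_actM.
- by move=> c; rewrite env_act1.
Defined.

End EnvelopingSpace.

(* Main.v *)
Require Import Defs.
From mathcomp Require Import all_boot all_order all_algebra.
From mathcomp Require Import all_classical all_reals.
From mathcomp Require Import topology normedtype.

Set Implicit Arguments.
Unset Strict Implicit.
Unset Printing Implicit Defensive.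

Local Open Scope classical_set_scope.

(* Write i : X -> X_G for x |-> [1, x] and K = G_x. Niceness makes i an open
   embedding that commutes with the (partial) actions, so G_(i x) = K. Since
   X_G is the union of the translates of i(X), only the points i x matter. The
   one gap between X and X_G is that invariance in X is a condition on defined
   translates only. It is closed by passing from an invariant set S to the set
   of those v in S at which all of K acts: this set is invariant, its image
   under i is invariant in X_G, and by compactness of the closure of K it is
   still a neighborhood of x. *)

(** * Continuity of composites on subsets *)

(** The form of every transported homotopy: [h] is a given one, continuous only within [B], while
    [f] and [g] carry points over and back. *)
Lemma within_continuous_conj (S T Y Z : topologicalType) (A : set S)
    (B : set T) (f : S -> T) (h : T -> Y) (g : Y -> Z) :
  {within B, continuous h} ->
  (forall x, A x -> {for x, continuous f}) -> (forall x, A x -> B (f x)) ->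
  (forall x, A x -> {for h (f x), continuous g}) ->
  {within A, continuous (fun x => g (h (f x)))}.
Proof.
move=> /subspace_continuousP hc fc fAB gc; apply/subspace_continuousP => x Ax.
apply: (@cvg_comp _ _ _ (h \o f) g _ (nbhs (h (f x)))); last exact: gc.
apply: (@cvg_comp _ _ _ f h _ (within B (nbhs (f x)))); last exact/hc/fAB.
move=> P /= /(fc x Ax) /=; rewrite /nbhs /=.
by apply: filterS => y /= BP Ay; apply: BP; exact: fAB.
Qed.

Lemma continuous_pair_fst (S T Y : topologicalType) (f : S -> Y) (p : S * T) :
  {for p.1, continuous f} ->
  {for p, continuous (fun q : S * T => (f q.1, q.2))}.
Proof.
move=> fc; apply: cvg_pair; last exact: cvg_snd.
by apply: (@continuous_comp _ _ _ fst f); first exact: cvg_fst.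
Qed.

(** * Isotropy groups and the points at which they act *)

Section PartialActions.
Variables (G : topologicalGroupType) (X : topologicalType).
Variable th : partial_action G X.
Local Open Scope group_scope.

Lemma isotropyM x g h :
  isotropy th x g -> isotropy th x h -> isotropy th x (g * h).
Proof.
move=> [dg eg] [dh eh].
have dgh : pdom th (g, pact th h x) by rewrite eh.
by have [d e] := pactM dh dgh; split=> //; rewrite -e eh.
Qed.

(** Write [g] as [(g * h) * h^-1]: by (PA1) [h^-1] takes [pact th h x] back to [x], where [g * h]
    acts. *)
Lemma pdomM_pact g h x :
  pdom th (h, x) -> pdom th (g * h, x) -> pdom th (g, pact th h x).
Proof.
move=> dh dgh; have [dV eV] := pactVK dh.
have dgh' : pdom th (g * h, pact th h^-1 (pact th h x)) by rewrite eV.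
by have [] := pactM dV dgh'; rewrite mulgK.
Qed.

Definition acting_core (K : set G) (S : set X) : set X :=
  [set v | S v /\ forall k, K k -> pdom th (k, v)].

(** An element k' of the isotropy group acts at k v because k' k, again in the group, acts at v. *)
Lemma acting_core_pact x S k v : invariant_set th (isotropy th x) S ->
  isotropy th x k -> acting_core (isotropy th x) S v ->
  acting_core (isotropy th x) S (pact th k v).
Proof.
move=> [_ Sinv] Kk [Sv dv]; split; first exact: Sinv (dv _ Kk).
by move=> k' Kk'; apply: pdomM_pact (dv _ Kk) (dv _ _); exact: isotropyM.
Qed.

Lemma continuous_mulgl (g : G) : continuous (fun h : G => g * h).
Proof.
move=> h; apply: (@continuous_comp _ _ _ (fun h : G => (g, h))
  (fun p : G * G => p.1 * p.2)); last exact: mulg_continuous.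
by apply: cvg_pair; [exact: cvg_cst | exact: cvg_id].
Qed.

Hypothesis dom_open : open (pdom th).

(* [g] in the closure of [K] factors as [(g k^-1) k] with [k] in [K] and
   [g k^-1] so close to [1] that it acts at [x = k x]. *)
Lemma closure_isotropy_pdom x g :
  closure (isotropy th x) g -> pdom th (g, x).
Proof.
move=> clg; pose f (k : G) : G * X := (g * k^-1, x).
have fc : {for g, continuous f}.
  apply: cvg_pair; last exact: cvg_cst.
  apply: (@continuous_comp _ _ _ (fun k : G => k^-1) (fun k => g * k)).
    exact: invg_continuous.
  exact: continuous_mulgl.
have nf : nbhs g (f @^-1` pdom th).
  apply: fc; apply: open_nbhs_nbhs; split=> //.
  by rewrite /f mulgV; have [] := pact1 th x.
have [k [[dk ek] dgk]] := clg _ nf.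
have {}dgk : pdom th (g * k^-1, pact th k x) by rewrite ek.
by have [] := pactM dk dgk; rewrite mulgVK.
Qed.

(** A tube lemma: the open domain contains the product of {x} with the compact closure of K, hence
    also its product with a neighborhood of x. *)
Lemma nbhs_acting_core x S : compact [set: G] -> nbhs x S ->
  nbhs x (acting_core (isotropy th x) S).
Proof.
move=> Gc nS; apply: filterI => //.
have cK : compact (closure (isotropy th x)).
  by apply: subclosed_compact Gc _ => //; exact: closed_closure.
have near_dom k : closure (isotropy th x) k ->
    \forall k' \near k & v \near nbhs x, pdom th (k', v).
  move=> /closure_isotropy_pdom dk.
  have [[A B] nAB sub] : nbhs (k, x) (pdom th) by exact: open_nbhs_nbhs.
  by exists (A, B) => // -[a b] /sub.
have /compact_near_coveringP cov := cK.
have := cov X (nbhs x) (fun v k => pdom th (k, v)) (nbhs_filter x) near_dom.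
by apply: filterS => v dv k Kk; apply: dv; exact: subset_closure.
Qed.

End PartialActions.

(** * The open equivariant embedding of X in its enveloping space *)

Section EnvelopingEmbedding.
Variables (G : topologicalGroupType) (X : topologicalType).
Variable th : partial_action G X.
Local Open Scope group_scope.

Notation XG := (enveloping_space th).
Notation mu := (enveloping_action th).

Definition env_incl (x : X) : XG := env_class th 1 x.

Lemma env_class_continuous : continuous (fun p : G * X => env_class th p.1 p.2).
Proof.
have -> : (fun p : G * X => env_class th p.1 p.2) =
    \pi_(quotient_topology {eq_quot env_equiv th})%qT.
  by apply/funext => -[].
exact: pi_continuous.
Qed.

Lemma env_incl_inj : injective env_incl.
Proof.
move=> x y /env_class_eq; rewrite mulVg => -[_ <-].
by have [] := pact1 th x.
Qed.

Lemma env_incl_continuous : continuous env_incl.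
Proof.
move=> x; apply: (@continuous_comp _ _ _ (fun x : X => ((1 : G), x))
  (fun p : G * X => env_class th p.1 p.2)); last exact: env_class_continuous.
by apply: cvg_pair; [exact: cvg_cst | exact: cvg_id].
Qed.

Lemma env_class_incl g x y : env_class th g x = env_incl y <->
  pdom th (g, x) /\ pact th g x = y.
Proof.
rewrite /env_incl; split; first by move=> /env_class_eq; rewrite invg1 mul1g.
by move=> ?; apply/env_class_eq; rewrite invg1 mul1g.
Qed.

Lemma env_act_incl g x :
  pdom th (g, x) -> env_act g (env_incl x) = env_incl (pact th g x).
Proof. by move=> d; rewrite env_actE mulg1; apply/env_class_incl. Qed.

Lemma isotropy_env_incl x : isotropy mu (env_incl x) = isotropy th x.
Proof.
apply/seteqP; split=> g.
  by move=> [_ /=]; rewrite env_actE mulg1 => /env_class_incl.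
by move=> dg; split=> //=; rewrite env_actE mulg1; apply/env_class_incl.
Qed.

Lemma env_incl_open (O : set X) : continuous_action th -> open (pdom th) ->
  open O -> open (env_incl @` O).
Proof.
move=> cth od oO; rewrite /open /= /quotient_open.
(* [g, x] lies in the image of [O] exactly when g x is defined and lies in [O]; on the open domain
   this is an open condition. *)
rewrite (_ : _ @^-1` _ =
    pdom th `&` (fun p : G * X => pact th p.1 p.2) @^-1` O).
  have := cth; rewrite /continuous_action continuous_open_subspace//.
  by move=> /(continuous_inP _ od); exact.
apply/seteqP; split=> -[g x] /=.
  by move=> [y Oy /esym/env_class_incl[dg e]]; split=> //=; rewrite e.
by move=> [dg Og]; exists (pact th g x) => //; apply/esym/env_class_incl.
Qed.

Lemma nbhs_env_incl x (S : set X) : continuous_action th -> open (pdom th) ->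
  nbhs x S -> nbhs (env_incl x) (env_incl @` S).
Proof.
move=> cth od; rewrite nbhsE => -[O [oO Ox] OS].
apply: (@filterS _ _ _ (env_incl @` O)); first exact: image_subset.
by apply: open_nbhs_nbhs; split; [exact: env_incl_open | exists x].
Qed.

(** By the universal property of the quotient, it is enough to translate the first coordinate in G *
    X. *)
Lemma env_act_continuous (g : G) : continuous (env_act g : XG -> XG).
Proof.
apply/quotient_continuous => p.
have -> : env_act g \o \pi_(quotient_topology {eq_quot env_equiv th})%qT =
    (fun q : G * X => env_class th q.1 q.2) \o
    (fun q : G * X => (g * q.1, q.2)).
  by apply/funext => -[h x]; exact: env_actE.
apply: continuous_comp; last exact: env_class_continuous.
by apply: (@continuous_pair_fst _ _ _ (fun h : G => g * h));
  exact: continuous_mulgl.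
Qed.

End EnvelopingEmbedding.

(** * Transport of local contractibility *)

Section LocalContractibility.
Variables (R : realType) (G : topologicalGroupType).
Local Open Scope group_scope.

(** Stated at a single point so that it can be moved along orbits and through the embedding. *)
Definition locally_contractible_at (X : topologicalType)
    (th : partial_action G X) (x : X) : Prop :=
  forall U : set X, nbhs x U -> invariant_set th (isotropy th x) U ->
  exists V : set X, [/\ nbhs x V, invariant_set th (isotropy th x) V, V `<=` U &
    contractible_in th R (isotropy th x) V U].

Variables (X : topologicalType) (th : partial_action G X).
Notation mu := (enveloping_action th).
Notation i := (env_incl th).

Lemma isotropy_env_act g h c :
  isotropy mu (env_act g c) h <-> isotropy mu c (g^-1 * h * g).
Proof.
split=> -[_ /= e]; split=> //=.
  by rewrite -env_actM -env_actM e env_actM mulVg env_act1.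
by rewrite -[in RHS]e !env_actM -!mulgA mulVKg.
Qed.

(** Translation by g is a homeomorphism that conjugates isotropy groups, so neighborhoods and
    homotopies at c are carried to g c. *)
Lemma locally_contractible_env_act g c :
  locally_contractible_at mu c -> locally_contractible_at mu (env_act g c).
Proof.
move=> lc U nU [_ Uinv].
have actVK : env_act g^-1 (env_act g c) = c by rewrite env_actM mulVg env_act1.
have isoJ k : isotropy mu c k -> isotropy mu (env_act g c) (g * k * g^-1).
  by move=> Kk; apply/isotropy_env_act; rewrite -!mulgA mulKg mulVg mulg1.
have [||V [nV [_ Vinv] VU [H [cH HU H0 [w [Uw wfix H1]] Heq]]]] :=
    lc (env_act g @^-1` U).
- exact: env_act_continuous.
- split; first by exists c; exact: nbhs_singleton nU.
  move=> k s /isoJ Kk Us _ /=.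
  by have := Uinv _ _ Kk Us I; rewrite /= !env_actM mulgVK.
exists (env_act g^-1 @^-1` V); split.
- by apply: env_act_continuous; rewrite actVK.
- split; first by exists (env_act g c); rewrite /= actVK; exact: nbhs_singleton.
  move=> k s /isotropy_env_act Kk Vs _ /=.
  by have := Vinv _ _ Kk Vs I; rewrite /= !env_actM mulgK.
- by move=> s /VU /=; rewrite env_actM mulgV env_act1.
exists (fun p => env_act g (H (env_act g^-1 p.1, p.2))); split=> /=.
- apply: (within_continuous_conj
    (f := fun p => (env_act g^-1 p.1, p.2)) (g := (env_act g)) cH) => //.
  + move=> p _; apply: continuous_pair_fst; exact: env_act_continuous.
  + by move=> p _; exact: env_act_continuous.
- by move=> v t Vv It; exact: HU.
- by move=> v Vv; rewrite H0// env_actM mulgV env_act1.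
- exists (env_act g w); split=> //.
    by move=> k /isotropy_env_act/wfix ?; exact/isotropy_env_act.
  by move=> v Vv; rewrite H1.
move=> k v t /isotropy_env_act Kk Vv It _; split=> //.
have [_ /= e] := Heq _ _ _ Kk Vv It I.
have -> : env_act g^-1 (env_act k v) =
    env_act (g^-1 * k * g) (env_act g^-1 v) by rewrite !env_actM mulgK.
by rewrite -e !env_actM -!mulgA mulVKg.
Qed.

Hypothesis G_compact : compact [set: G].
Hypothesis th_continuous : continuous_action th.
Hypothesis dom_open : open (pdom th).

Lemma acting_core_env_incl x S : nbhs x S ->
  invariant_set th (isotropy th x) S ->
  nbhs (i x) (i @` acting_core th (isotropy th x) S) /\
  invariant_set mu (isotropy mu (i x))
    (i @` acting_core th (isotropy th x) S).
Proof.
move=> nS Sinv; have nC := nbhs_acting_core dom_open G_compact nS.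
split; first exact: nbhs_env_incl.
split; first by exists (i x); exists x => //; exact: nbhs_singleton nC.
move=> k s; rewrite isotropy_env_incl => Kk [v Cv <-] _.
exists (pact th k v); first exact: acting_core_pact.
by rewrite /= env_act_incl//; exact: Cv.2.
Qed.

(** The inverse of the embedding on its image; elsewhere it takes the junk value [x0]. *)
Definition env_incl_inv (x0 : X) (c : enveloping_space th) : X :=
  xget x0 [set x | i x = c].

Lemma env_inclK x0 : cancel i (env_incl_inv x0).
Proof.
move=> x; rewrite /env_incl_inv.
apply: (@env_incl_inj _ _ th).
exact: (@xgetI _ x0 [set y | i y = i x] x (erefl _)).
Qed.

(** This is openness of the embedding: the image of a neighborhood of x is a neighborhood of i x. *)
Lemma env_incl_inv_continuous x0 x :
  {for i x, continuous (env_incl_inv x0)}.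
Proof.
move=> P; rewrite env_inclK => nP.
have := nbhs_env_incl th_continuous dom_open nP.
by apply: filterS => _ [y Py <-] /=; rewrite env_inclK.
Qed.

(** Pull [U] back to X, contract some [V] there, and push forward only the acting core of [V], whose
    image is invariant. *)
Lemma locally_contractible_env_incl x :
  locally_contractible_at th x -> locally_contractible_at mu (i x).
Proof.
move=> lc U nU [_ Uinv]; pose j := env_incl_inv x.
have iK v : j (i v) = v by exact: env_inclK.
pose K := isotropy th x.
have KE : isotropy mu (i x) = K by exact: isotropy_env_incl.
have [||V [nV Vinv VU [H [cH HU H0 [w [Uw wfix H1]] Heq]]]] :=
    lc (i @^-1` U).
- exact: env_incl_continuous.
- split; first by exists x; exact: nbhs_singleton nU.
  move=> k s Kk Us dks /=; rewrite -env_act_incl//.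
  by apply: Uinv => //; rewrite KE.
have [nC Cinv] := acting_core_env_incl nV Vinv.
exists (i @` acting_core th K V); split=> //.
  by move=> _ [v [Vv _] <-]; exact: VU.
exists (fun p => i (H (j p.1, p.2))); split=> /=.
- apply: (within_continuous_conj
    (f := fun p => (j p.1, p.2)) (g := i) cH) => //.
  + move=> [_ t] [/= [v _ <-] _]; apply: (continuous_pair_fst (f := j)).
    exact: env_incl_inv_continuous.
  + by move=> [_ t] [/= [v [Vv _] <-] It]; split=> //=; rewrite iK.
  + by move=> p _; exact: env_incl_continuous.
- by move=> _ t [v [Vv _] <-] It; rewrite iK; exact: HU.
- by move=> _ [v [Vv _] <-]; rewrite iK H0.
- exists (i w); split=> //; first by rewrite KE isotropy_env_incl.
  by move=> _ [v [Vv _] <-]; rewrite iK H1.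
move=> k _ t + [v [Vv dv] <-] It _; rewrite KE => Kk; split=> //.
(* Equivariance in X requires k to act at [v]; membership in the core ensures it. *)
have [dH eH] := Heq _ _ _ Kk Vv It (dv _ Kk).
by rewrite iK !env_act_incl// ?iK ?eH//; exact: dv.
Qed.

(** Here [U] is cut down to its core first. The homotopy in the enveloping space then stays in the
    image of that core, so it can be pulled back to X. *)
Lemma locally_contractible_of_env_incl x :
  locally_contractible_at mu (i x) -> locally_contractible_at th x.
Proof.
move=> lc U nU Uinv; pose j := env_incl_inv x.
have iK v : j (i v) = v by exact: env_inclK.
pose K := isotropy th x; pose C := acting_core th K U.
have KE : isotropy mu (i x) = K by exact: isotropy_env_incl.
have [nC Cinv] := acting_core_env_incl nU Uinv.
have [V [nV [_ Vinv] VC [H [cH HC H0 [_ [[w Cw <-] wfix H1]] Heq]]]] :=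
  lc _ nC Cinv.
have Vcore v : V (i v) -> C v.
  by move=> /VC[u Cu /env_incl_inj <-].
exists (i @^-1` V); split.
- exact: env_incl_continuous.
- split; first by exists x; exact: nbhs_singleton nV.
  move=> k s Kk Vs dks /=; rewrite -env_act_incl//.
  by apply: Vinv => //; rewrite KE.
- by move=> v /Vcore[].
exists (fun p => j (H (i p.1, p.2))); split=> /=.
- apply: (within_continuous_conj
    (f := fun p => (i p.1, p.2)) (g := j) cH) => //.
  + move=> p _; apply: continuous_pair_fst; exact: env_incl_continuous.
  + move=> [v t] [/= Vv It]; have [u _ <-] := HC _ _ Vv It.
    exact: env_incl_inv_continuous.
- by move=> v t Vv It; have [u [Uu _] <-] := HC _ _ Vv It; rewrite iK.
- by move=> v Vv; rewrite H0// iK.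
- exists w; split; first exact: Cw.1.
    by move: wfix; rewrite !isotropy_env_incl.
  by move=> v Vv; rewrite H1// iK.
move=> k v t Kk Vv It dkv.
(* The value of the homotopy is i u with u in the core, so k acts at u; this is the domain condition
   that equivariance in X demands. *)
have [u [_ du] eu] := HC _ _ Vv It; have dku := du _ Kk.
have Kk' : isotropy mu (i x) k by rewrite KE.
have [_ /= e] := Heq _ _ _ Kk' Vv It I.
by rewrite -eu iK -env_act_incl// -e -eu env_act_incl// iK.
Qed.

End LocalContractibility.

Theorem theorem4p9 (R : realType) (G : topologicalGroupType)
    (X : topologicalType) (theta : partial_action G X)
    (G_compact : compact [set: G]) (G_hausdorff : hausdorff_space G)
    (theta_G_space : is_G_space theta) (theta_nice : nice_action theta) :
  locally_contractible theta R <->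
  locally_contractible (enveloping_action theta) R.
Proof.
have [cont dom_open] := theta_nice; split=> lc x.
  (* Every point [g, y] is the translate g [1, y] of a point of the embedded X. *)
  rewrite -[x]env_reprK -[(env_repr x).1]mulg1 -env_actE.
  apply: locally_contractible_env_act.
  apply: locally_contractible_env_incl => //; exact: lc.
by apply: locally_contractible_of_env_incl => //; exact: lc.
Qed.
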